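(* (Relational FMP) $\mathbf{tHC}$ is sound and complete with respect to the class of finite temporal transits.
   Context: Write $\mathsf{P}$ for the ''past diamond'' operator (black diamond). $\mathbf{mHC}$ is the smallest set of formulas in $\wedge,\vee,\to,\Box,\bot,\top$ containing intuitionistic propositional logic and $\Box(p\to q)\to(\Box p\to\Box q)$, $p\to\Box p$, $\Box p\to(q\vee(q\to p))$, closed under modus ponens and uniform substitution. $\mathbf{tHC}$ is the smallest set of formulas in the language extended with $\mathsf{P}$ containing $\mathbf{mHC}$ and $\mathsf{P}(p\vee q)\to(\mathsf{P}p\vee\mathsf{P}q)$, $\mathsf{P}\bot\to\bot$, $p\to\Box\mathsf{P}p$, $\mathsf{P}\Box p\to p$, closed under modus ponens, uniform substitution and the rule from $\varphi\to\chi$ infer $\mathsf{P}\varphi\to\mathsf{P}\chi$. A temporal transit is $(X,R^{\lhd},R^{\rhd},\le)$ where $\le$ is a partial order equal to the reflexive closure of $R^{\rhd}$ and $R^{\lhd}$ is the inverse of $R^{\rhd}$. Formulas are evaluated with valuations into upsets of $\le$, intuitionistic clauses for $\to$ via $\le$, $x\models\Box\varphi$ iff $y\models\varphi$ for all $y$ with $xR^{\rhd}y$, and $x\models\mathsf{P}\varphi$ iff $w\models\varphi$ for some $w$ with $xR^{\lhd}w$. *)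

(* Defs.v *)
From Stdlib Require Import Relations.
From mathcomp Require Import ssreflect ssrfun ssrbool eqtype fintype.

Set Implicit Arguments.
Unset Strict Implicit.
Unset Printing Implicit Defensive.

Inductive form : Type :=
| Var of nat
| Bot
| Top
| And of form & form
| Or of form & form
| Imp of form & form
| Box of form
| Past of form.

Declare Scope form_scope.
Delimit Scope form_scope with form.
Bind Scope form_scope with form.
Notation "''p_' n" := (Var n) (at level 8, n at level 2, format "''p_' n") :
  form_scope.
Notation "⊥" := Bot : form_scope.
Notation "⊤" := Top : form_scope.
Notation "A ∧ B" := (And A B) (at level 48, left associativity) : form_scope.
Notation "A ∨ B" := (Or A B) (at level 53, left associativity) : form_scope.
Notation "A ⇒ B" := (Imp A B) (at level 61, right associativity) : form_scope.
Notation "□ A" := (Box A) (at level 40, A at level 40) : form_scope.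
Notation "◆ A" := (Past A) (at level 40, A at level 40) : form_scope.

(* The language of intuitionistic logic: neither Box nor Past. *)
Fixpoint int_form (A : form) : bool :=
  match A with
  | Var _ | Bot | Top => true
  | And B C | Or B C | Imp B C => int_form B && int_form C
  | Box _ | Past _ => false
  end.

(* The language of mHC: no Past. *)
Fixpoint modal_form (A : form) : bool :=
  match A with
  | Var _ | Bot | Top => true
  | And B C | Or B C | Imp B C => modal_form B && modal_form C
  | Box B => modal_form B
  | Past _ => false
  end.

Fixpoint subst (s : nat -> form) (A : form) : form :=
  match A with
  | Var n => s n
  | Bot => Bot
  | Top => Top
  | And B C => And (subst s B) (subst s C)
  | Or B C => Or (subst s B) (subst s C)
  | Imp B C => Imp (subst s B) (subst s C)
  | Box B => Box (subst s B)
  | Past B => Past (subst s B)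
  end.

(* In each of the three logics below, uniform substitution is restricted to
   substitutions with values in the language of that logic, so that IPC is a
   subset of int_form and mHC a subset of modal_form. *)

Section Logics.
Local Open Scope form_scope.

Inductive IPC : form -> Prop :=
| IPC_K : IPC ('p_0 ⇒ 'p_1 ⇒ 'p_0)
| IPC_S : IPC (('p_0 ⇒ 'p_1 ⇒ 'p_2) ⇒ ('p_0 ⇒ 'p_1) ⇒ 'p_0 ⇒ 'p_2)
| IPC_andl : IPC ('p_0 ∧ 'p_1 ⇒ 'p_0)
| IPC_andr : IPC ('p_0 ∧ 'p_1 ⇒ 'p_1)
| IPC_and : IPC ('p_0 ⇒ 'p_1 ⇒ 'p_0 ∧ 'p_1)
| IPC_orl : IPC ('p_0 ⇒ 'p_0 ∨ 'p_1)
| IPC_orr : IPC ('p_1 ⇒ 'p_0 ∨ 'p_1)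
| IPC_or : IPC (('p_0 ⇒ 'p_2) ⇒ ('p_1 ⇒ 'p_2) ⇒ 'p_0 ∨ 'p_1 ⇒ 'p_2)
| IPC_bot : IPC (⊥ ⇒ 'p_0)
| IPC_top : IPC ⊤
| IPC_mp A B : IPC (A ⇒ B) -> IPC A -> IPC B
| IPC_subst s A : (forall n, int_form (s n)) -> IPC A -> IPC (subst s A).

Inductive mHC : form -> Prop :=
| mHC_IPC A : IPC A -> mHC A
| mHC_K : mHC (□ ('p_0 ⇒ 'p_1) ⇒ □ 'p_0 ⇒ □ 'p_1)
| mHC_box : mHC ('p_0 ⇒ □ 'p_0)
| mHC_transit : mHC (□ 'p_0 ⇒ 'p_1 ∨ ('p_1 ⇒ 'p_0))
| mHC_mp A B : mHC (A ⇒ B) -> mHC A -> mHC B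
| mHC_subst s A : (forall n, modal_form (s n)) -> mHC A -> mHC (subst s A).

Inductive tHC : form -> Prop :=
| tHC_mHC A : mHC A -> tHC A
| tHC_past_or : tHC (◆ ('p_0 ∨ 'p_1) ⇒ ◆ 'p_0 ∨ ◆ 'p_1)
| tHC_past_bot : tHC (◆ ⊥ ⇒ ⊥)
| tHC_box_past : tHC ('p_0 ⇒ □ ◆ 'p_0)
| tHC_past_box : tHC (◆ □ 'p_0 ⇒ 'p_0)
| tHC_mp A B : tHC (A ⇒ B) -> tHC A -> tHC B
| tHC_subst s A : tHC A -> tHC (subst s A)
| tHC_past A B : tHC (A ⇒ B) -> tHC (◆ A ⇒ ◆ B).

End Logics.

Record temporal_transit (X : Type) : Type := TemporalTransit {
  Rpast : relation X;
  Rfut : relation X;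
  le : relation X;
  le_order : order X le;
  le_clos_refl : forall x y, le x y <-> clos_refl X Rfut x y;
  Rpast_transp : forall x y, Rpast x y <-> transp X Rfut x y
}.

Section Semantics.
Variables (X : Type) (F : temporal_transit X).

Definition upset (U : X -> Prop) : Prop :=
  forall x y, le F x y -> U x -> U y.

Fixpoint forces (V : nat -> X -> Prop) (x : X) (A : form) : Prop :=
  match A with
  | Var n => V n x
  | Bot => False
  | Top => True
  | And B C => forces V x B /\ forces V x C
  | Or B C => forces V x B \/ forces V x C
  | Imp B C => forall y, le F x y -> forces V y B -> forces V y C
  | Box B => forall y, Rfut F x y -> forces V y B
  | Past B => exists w, Rpast F x w /\ forces V w B
  end.

Definition valid (A : form) : Prop :=
  forall V : nat -> X -> Prop, (forall n, upset (V n)) ->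
  forall x, forces V x A.

End Semantics.

(* Main.v *)
From HB Require Import structures.
Require Import Defs.
From Stdlib Require Import Relations Classical ClassicalEpsilon.
From mathcomp Require Import ssreflect ssrfun ssrbool eqtype fintype.
From mathcomp Require Import ssrnat seq choice finset.

(** Completeness goes through the canonical model of prime theories, where
    [G] sees [D] when [□ B] in [G] forces [B] in [D]; the adjunction between
    [◆] and [□] makes this equivalent to [◆ B] being in [D] for every [B] in
    [G].  The axiom [□ p ⇒ q ∨ (q ⇒ p)] says exactly that a proper inclusion of
    prime theories is an instance of this relation.  Filtrate through the
    subformulas of a refuted formula, let the future relation be the transitive
    closure of the smallest filtration, and let the order be its reflexive
    closure.  Both are contained in inclusion of types, which gives antisymmetry,
    and the modal clauses survive the transitive closure because formulas
    persist along it. *)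

Local Open Scope form_scope.

(** * Soundness *)

Section Soundness.
Context {X : Type} (F : temporal_transit X).

Lemma le_refl x : le F x x.
Proof. by case: (le_order F). Qed.

Lemma le_trans {x y z} : le F x y -> le F y z -> le F x z.
Proof. by case: (le_order F) => _ tr _; apply: tr. Qed.

Lemma le_antisym {x y} : le F x y -> le F y x -> x = y.
Proof. by case: (le_order F) => _ _; apply. Qed.

Lemma Rfut_le {x y} : Rfut F x y -> le F x y.
Proof. by move=> xy; apply/le_clos_refl; apply: r_step. Qed.

Lemma le_Rfut {x y} : le F x y -> x = y \/ Rfut F x y.
Proof. by move/le_clos_refl; case=> [z xz|]; [right|left]. Qed.

(** [Rfut] need be neither reflexive nor irreflexive. If the composite collapses to [x = z],
    antisymmetry gives [x = y], so the given [Rfut] step is itself a loop at [x]. The mirror lemma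
    is proved alike. *)
Lemma le_Rfut_trans {x y z} : le F x y -> Rfut F y z -> Rfut F x z.
Proof.
move=> xy yz; case: (le_Rfut (le_trans xy (Rfut_le yz))) => // xz.
by rewrite -xz in yz *; rewrite {1}(le_antisym xy (Rfut_le yz)).
Qed.

Lemma Rfut_le_trans {x y z} : Rfut F x y -> le F y z -> Rfut F x z.
Proof.
move=> xy yz; case: (le_Rfut (le_trans (Rfut_le xy) yz)) => // xz.
by rewrite -xz in yz *; rewrite -{2}(le_antisym yz (Rfut_le xy)).
Qed.

(** Absorption of [le] on the left of [Rfut] serves [□], on the right [◆]. Persistence also makes
    the truth set of a formula an admissible value of a variable, on which soundness of substitution
    rests. *)
Lemma forces_upset V B :
  (forall n, upset F (V n)) -> upset F (fun x => forces F V x B).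
Proof.
move=> upV; elim: B => [n|||B IHB C IHC|B IHB C IHC|B _ C _|B _|B _] x y xy //=.
- exact: upV.
- by case=> hB hC; split; [apply: IHB hB|apply: IHC hC].
- by case=> [hB|hC]; [left; apply: IHB hB|right; apply: IHC hC].
- by move=> h z yz; apply: h; apply: le_trans yz.
- by move=> h z yz; apply: h; apply: le_Rfut_trans yz.
- case=> w [/Rpast_transp wx hB]; exists w; split => //.
  by apply/Rpast_transp; apply: Rfut_le_trans xy.
Qed.

Lemma forces_subst V s B x :
  forces F V x (subst s B) <-> forces F (fun n y => forces F V y (s n)) x B.
Proof.
elim: B x => [n|||B IHB C IHC|B IHB C IHC|B IHB C IHC|B IHB|B IHB] x //=.
- by rewrite IHB IHC.
- by rewrite IHB IHC.
- by split=> h y xy /IHB /(h y xy) /IHC.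
- by split=> h y xy; apply/IHB/h.
- by split=> -[w [xw /IHB hB]]; exists w.
Qed.

Lemma valid_subst s B : valid F B -> valid F (subst s B).
Proof.
move=> vB V upV x; apply/forces_subst/vB => n.
exact: forces_upset.
Qed.

Lemma valid_mp B C : valid F (B ⇒ C) -> valid F B -> valid F C.
Proof. by move=> vBC vB V upV x; apply: (vBC V upV x x (le_refl x)); apply: vB. Qed.

Lemma IPC_valid B : IPC B -> valid F B.
Proof.
elim=> {B} [||||||||||B C _ vBC _ vB|s B _ _ vB];
  [.. | exact: valid_mp vBC vB | exact: valid_subst]; move=> V upV x //=.
- by move=> y _ h z yz _; apply: upV yz h.
- move=> y _ h z yz h' t zt h0.
  apply: (h t (le_trans yz zt) h0 t (le_refl t)).
  exact: h'.
- by move=> y _ [].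
- by move=> y _ [].
- by move=> y _ h z yz h'; split => //; apply: upV yz h.
- by move=> y _; left.
- by move=> y _; right.
- move=> y _ h z yz h' t zt [] h0; last exact: h'.
  by apply: h h0; apply: le_trans zt.
Qed.

Lemma mHC_valid B : mHC B -> valid F B.
Proof.
elim=> {B} [B /IPC_valid //||||B C _ vBC _ vB|s B _ _ vB];
  [.. | exact: valid_mp vBC vB | exact: valid_subst]; move=> V upV x /=.
- move=> y _ h z yz h' t zt.
  by apply: (h t (le_Rfut_trans yz zt) t (le_refl t)); apply: h'.
- by move=> y _ h z /Rfut_le yz; apply: upV yz h.
(* If q fails at [y], a point above [y] where q holds is not [y] itself, so it is an
   [Rfut]-successor and [□ p] applies. *)
- move=> y _ h; case: (classic (V 1%N y)) => [|nq]; [by left|right=> z yz q].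
  case: (le_Rfut yz) => [yz'|]; last exact: h.
  by case: nq; rewrite yz'.
Qed.

Lemma tHC_valid B : tHC B -> valid F B.
Proof.
elim=> {B} [B /mHC_valid //|||||B C _ vBC _ vB|s B _ vB|B C _ vBC];
  [.. | exact: valid_mp vBC vB | exact: valid_subst |]; move=> V upV x /=.
- by move=> y _ [w [yw [h|h]]]; [left|right]; exists w.
- by move=> y _ [w [_ []]].
- by move=> y _ h z yz; exists y; split => //; apply/Rpast_transp.
- by move=> y _ [w [/Rpast_transp wy h]]; apply: h.
- move=> y _ [w [yw hB]]; exists w; split => //.
  exact: (vBC V upV w w (le_refl w)).
Qed.

End Soundness.

(** * Derivations *)

Definition subst3 (B C D : form) (n : nat) : form :=
  match n with 0 => B | 1 => C | _ => D end.

Section Derivations.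
Implicit Types B C D : form.

(** [IPC] only admits substitutions inside its own language, so the axiom is first moved into [tHC],
    where any formulas may be substituted. *)
Lemma tHC_IPC_inst {B} C1 C2 C3 : IPC B -> tHC (subst (subst3 C1 C2 C3) B).
Proof. by move=> /mHC_IPC/tHC_mHC; apply: tHC_subst. Qed.

Lemma tHC_mHC_inst {B} C1 C2 C3 : mHC B -> tHC (subst (subst3 C1 C2 C3) B).
Proof. by move/tHC_mHC; apply: tHC_subst. Qed.

Lemma tHC_K B C : tHC (B ⇒ C ⇒ B).
Proof. exact: (tHC_IPC_inst B C Top IPC_K). Qed.

Lemma tHC_S B C D : tHC ((B ⇒ C ⇒ D) ⇒ (B ⇒ C) ⇒ B ⇒ D).
Proof. exact: (tHC_IPC_inst B C D IPC_S). Qed.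

Lemma tHC_id B : tHC (B ⇒ B).
Proof. exact: tHC_mp (tHC_mp (tHC_S B (B ⇒ B) B) (tHC_K _ _)) (tHC_K _ _). Qed.

End Derivations.

(** * Prime theories *)

Definition theory (T : form -> Prop) : Prop :=
  (forall B, tHC B -> T B) /\ (forall B C, T (B ⇒ C) -> T B -> T C).

Definition prime_theory (T : form -> Prop) : Prop :=
  [/\ theory T, ~ T Bot & forall B C, T (B ∨ C) -> T B \/ T C].

Section Theory.
Context {T : form -> Prop} (thT : theory T).
Implicit Types B C D : form.

Lemma theory_tHC {B} : tHC B -> T B.
Proof. exact: thT.1. Qed.

Lemma theory_mp {B C} : T (B ⇒ C) -> T B -> T C.
Proof. exact: thT.2. Qed.

Lemma theory_mp_tHC {B C} : tHC (B ⇒ C) -> T B -> T C.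
Proof. by move/theory_tHC; apply: theory_mp. Qed.

Lemma theory_imp_const {B C} : T C -> T (B ⇒ C).
Proof. exact: theory_mp_tHC (tHC_K _ _). Qed.

Lemma theory_S {B C D} : T (B ⇒ C ⇒ D) -> T (B ⇒ C) -> T (B ⇒ D).
Proof. by move=> h; apply: theory_mp; apply: theory_mp_tHC h; apply: tHC_S. Qed.

Lemma theory_imp_trans {B C D} : T (B ⇒ C) -> T (C ⇒ D) -> T (B ⇒ D).
Proof. by move=> h h'; apply: theory_S h; apply: theory_imp_const. Qed.

Lemma theory_and B C : T (B ∧ C) <-> T B /\ T C.
Proof.
split=> [h|[hB hC]].
  split; apply: theory_mp_tHC h.
    exact: (tHC_IPC_inst B C Top IPC_andl).
  exact: (tHC_IPC_inst B C Top IPC_andr).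
apply: theory_mp hC; apply: theory_mp_tHC hB.
exact: (tHC_IPC_inst B C Top IPC_and).
Qed.

Lemma theory_or_elim {B C D} : T (B ⇒ D) -> T (C ⇒ D) -> T (B ∨ C ⇒ D).
Proof.
move=> h; apply: theory_mp; apply: theory_mp_tHC h.
exact: (tHC_IPC_inst B C D IPC_or).
Qed.

(** By the deduction theorem this is the theory generated by [T] and [B]. *)
Lemma theory_adjoin B : theory (fun C => T (B ⇒ C)).
Proof.
split=> [C hC|C D]; last exact: theory_S.
by apply: theory_imp_const; apply: theory_tHC.
Qed.

Lemma theory_unbox : theory (fun B => T (□ B)).
Proof.
split=> [B /theory_tHC|B C h].
  by apply: theory_mp_tHC; apply: (tHC_mHC_inst B Top Top mHC_box).
apply: theory_mp; apply: theory_mp_tHC h.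
exact: (tHC_mHC_inst B C Top mHC_K).
Qed.

End Theory.

Lemma theory_tHC_set : theory tHC.
Proof. by split=> // B C; apply: tHC_mp. Qed.

Lemma tHC_orl B C : tHC (B ⇒ B ∨ C).
Proof. exact: (tHC_IPC_inst B C Top IPC_orl). Qed.

Lemma tHC_orr B C : tHC (C ⇒ B ∨ C).
Proof. exact: (tHC_IPC_inst B C Top IPC_orr). Qed.

Lemma prime_or {T} B C : prime_theory T -> T (B ∨ C) <-> T B \/ T C.
Proof.
case=> thT _ prT; split; first exact: prT.
by case; apply: theory_mp_tHC; [|exact: tHC_orl| |exact: tHC_orr].
Qed.

(** * Enumeration of formulas *)

Fixpoint form_tree (B : form) : GenTree.tree nat :=
  match B with
  | Var n => GenTree.Leaf n
  | Bot => GenTree.Node 0 [::]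
  | Top => GenTree.Node 1 [::]
  | And B C => GenTree.Node 2 [:: form_tree B; form_tree C]
  | Or B C => GenTree.Node 3 [:: form_tree B; form_tree C]
  | Imp B C => GenTree.Node 4 [:: form_tree B; form_tree C]
  | Box B => GenTree.Node 5 [:: form_tree B]
  | Past B => GenTree.Node 6 [:: form_tree B]
  end.

(** The last branch decodes [Bot] and also absorbs trees that code nothing. *)
Fixpoint tree_form (t : GenTree.tree nat) : form :=
  match t with
  | GenTree.Leaf n => Var n
  | GenTree.Node 1 _ => Top
  | GenTree.Node 2 [:: t; u] => And (tree_form t) (tree_form u)
  | GenTree.Node 3 [:: t; u] => Or (tree_form t) (tree_form u)
  | GenTree.Node 4 [:: t; u] => Imp (tree_form t) (tree_form u)
  | GenTree.Node 5 [:: t] => Box (tree_form t)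
  | GenTree.Node 6 [:: t] => Past (tree_form t)
  | _ => Bot
  end.

Lemma form_treeK : cancel form_tree tree_form.
Proof. by elim=> //= [B -> C ->|B -> C ->|B -> C ->|B ->|B ->]. Qed.

HB.instance Definition _ := Countable.copy form (can_type form_treeK).

Definition form_of_nat (n : nat) : form := odflt Bot (unpickle n).

Lemma form_of_nat_surj B : exists n, form_of_nat n = B.
Proof. by exists (pickle B); rewrite /form_of_nat pickleK. Qed.

(** * Lindenbaum extension to a prime theory avoiding an ideal *)

Section PrimeExtension.
Context (T I : form -> Prop) (thT : theory T).
Hypothesis I_bot : I Bot.
Hypothesis I_or : forall B C, I B -> I C -> I (B ∨ C).
Hypothesis TI : forall B, T B -> ~ I B.

(** The next formula is adjoined exactly when the enlarged theory still avoids [I]. The test is a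
    conjunct of membership, so the recursion makes no decision. *)
Fixpoint lindenbaum (n : nat) : form -> Prop :=
  if n is m.+1 then
    fun C => lindenbaum m C \/
      (forall D, lindenbaum m (form_of_nat m ⇒ D) -> ~ I D) /\
      lindenbaum m (form_of_nat m ⇒ C)
  else T.

Lemma lindenbaum_theory n : theory (lindenbaum n).
Proof.
elim: n => //= n IHn.
case: (classic (forall D, lindenbaum n (form_of_nat n ⇒ D) -> ~ I D)) => hI.
  have th := theory_adjoin IHn (form_of_nat n).
  split=> [B hB|B C hBC hB]; first by left; apply: (theory_tHC IHn).
  right; split=> //; apply: (theory_mp th (B := B)).
    by case: hBC => [|[]//]; apply: (theory_imp_const IHn).
  by case: hB => [|[]//]; apply: (theory_imp_const IHn).
split=> [B hB|B C [hBC|[]//] [hB|[]//]]; left; first exact: (theory_tHC IHn).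
exact: theory_mp hBC hB.
Qed.

Lemma lindenbaum_avoids n B : lindenbaum n B -> ~ I B.
Proof. by elim: n B => //= n IHn B [/IHn//|[hI] /hI]. Qed.

Lemma lindenbaum_mono {m n B} : (m <= n)%N -> lindenbaum m B -> lindenbaum n B.
Proof.
move/subnKC=> <-; elim: (n - m)%N => [|k IHk]; first by rewrite addn0.
by move=> hB; rewrite addnS /=; left; apply: IHk.
Qed.

Definition lindenbaum_lim (B : form) : Prop := exists n, lindenbaum n B.

Lemma lindenbaum_lim_theory : theory lindenbaum_lim.
Proof.
split=> [B hB|B C [m hm] [n hn]]; first by exists 0%N; apply: (theory_tHC thT hB).
exists (maxn m n); apply: (theory_mp (lindenbaum_theory _) (B := B)).
  by apply: lindenbaum_mono hm; apply: leq_maxl.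
by apply: lindenbaum_mono hn; apply: leq_maxr.
Qed.

(** A formula left out was rejected at its own stage, and rejection means that it implies some
    member of [I]. *)
Lemma lindenbaum_lim_maximal B :
  lindenbaum_lim B \/ exists2 D, lindenbaum_lim (B ⇒ D) & I D.
Proof.
have [n <-] := form_of_nat_surj B.
case: (classic (forall D, lindenbaum n (form_of_nat n ⇒ D) -> ~ I D)) => hI.
  left; exists n.+1; right; split=> //.
  exact: (theory_tHC (lindenbaum_theory n) (tHC_id _)).
right; apply: NNPP => nex; apply: hI => D hD iD.
by apply: nex; exists D => //; exists n.
Qed.

Lemma prime_extension :
  exists G, [/\ prime_theory G, forall B, T B -> G B & forall B, G B -> ~ I B].
Proof.
have avoid B : lindenbaum_lim B -> ~ I B by case=> n; apply: lindenbaum_avoids.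
have th := lindenbaum_lim_theory.
exists lindenbaum_lim; split=> //; last by move=> B hB; exists 0%N.
split=> // [/avoid //|B C hBC].
have [|[D hBD iD]] := lindenbaum_lim_maximal B; first by left.
have [|[E hCE iE]] := lindenbaum_lim_maximal C; first by right.
(* With both disjuncts left out, [B] implies [D] and [C] implies [E], so [D ∨ E] would lie both in
   the limit and in [I]. *)
case: (avoid (D ∨ E)); last exact: I_or.
apply: theory_mp hBC => //; apply: theory_or_elim => //.
  exact: (theory_imp_trans th hBD (theory_tHC th (tHC_orl _ _))).
exact: (theory_imp_trans th hCE (theory_tHC th (tHC_orr _ _))).
Qed.

End PrimeExtension.

(** The ideal to avoid consists of the formulas provably implying [C]: a theory meets it only if it
    contains [C]. *)
Lemma prime_extension_avoiding {T C} : theory T -> ~ T C ->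
  exists G, [/\ prime_theory G, forall B, T B -> G B & ~ G C].
Proof.
move=> thT nTC.
have [|||G [prG TG GI]] := @prime_extension T (fun B => tHC (B ⇒ C)) thT.
- exact: (tHC_IPC_inst C C C IPC_bot).
- by move=> B D; apply: (theory_or_elim theory_tHC_set).
- by move=> B TB hBC; apply: nTC; apply: theory_mp_tHC TB.
by exists G; split=> // /GI; apply; apply: tHC_id.
Qed.

(** * The canonical relation *)

Definition can_rel (G D : form -> Prop) : Prop := forall B, G (□ B) -> D B.

Section Canonical.
Context {G : form -> Prop} (prG : prime_theory G).
Let thG : theory G := let: And3 th _ _ := prG in th.

Lemma can_rel_sub {D B} : can_rel G D -> G B -> D B.
Proof.
move=> GD GB; apply: GD; apply: theory_mp_tHC GB => //.
exact: (tHC_mHC_inst B B B mHC_box).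
Qed.

Lemma can_rel_past {D B} : can_rel G D -> G B -> D (◆ B).
Proof.
move=> GD GB; apply: GD; apply: theory_mp_tHC GB => //.
exact: (tHC_subst (subst3 B B B) tHC_box_past).
Qed.

Lemma sub_can_rel {D} : theory D -> (forall B, G B -> D B) ->
  (forall B, D B <-> G B) \/ can_rel G D.
Proof.
move=> thD GD; case: (classic (exists2 B, D B & ~ G B)) => [[B DB nGB]|nex].
  right=> C GC; apply: (theory_mp thD) DB; apply: GD.
  (* As [B] is not in [G], primeness leaves [B ⇒ C], which [D] inherits and detaches with its member
     [B]. *)
  have /(prime_or _ _ prG)[//|//] : G (B ∨ (B ⇒ C)).
  apply: theory_mp_tHC GC => //.
  exact: (tHC_mHC_inst C B B mHC_transit).
left=> B; split; last exact: GD.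
by move=> DB; apply: NNPP => nGB; apply: nex; exists B.
Qed.

Lemma prime_imp_witness {B C} : ~ G (B ⇒ C) ->
  exists D, [/\ prime_theory D, forall E, G E -> D E, D B & ~ D C].
Proof.
case/(prime_extension_avoiding (theory_adjoin thG B)) => D [prD GD nDC].
exists D; split=> // [E GE|]; apply: GD.
  exact: theory_imp_const.
exact: (theory_tHC thG (tHC_id _)).
Qed.

Lemma prime_box_witness {B} : ~ G (□ B) ->
  exists D, [/\ prime_theory D, can_rel G D & ~ D B].
Proof. exact: prime_extension_avoiding (theory_unbox thG). Qed.

(** A predecessor must stay among the formulas [C] with [◆ C] in [G]. The complement is an ideal by
    the axioms on [◆ ⊥] and [◆ (p ∨ q)], and monotonicity of [◆] keeps the consequences of [B] out
    of it. *)
Lemma prime_past_witness {B} : G (◆ B) ->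
  exists D, [/\ prime_theory D, can_rel D G & D B].
Proof.
move=> GB.
have past_mono C E : tHC (C ⇒ E) -> G (◆ C) -> G (◆ E).
  by move/tHC_past; apply: theory_mp_tHC.
have [||||D [prD BD DG]] :=
  @prime_extension (fun C => tHC (B ⇒ C)) (fun C => ~ G (◆ C)).
- exact: theory_adjoin theory_tHC_set B.
- by case: prG => _ nbot _ /(theory_mp_tHC thG tHC_past_bot).
- move=> C E nC nE GCE.
  have /(prime_or _ _ prG)[//|//] : G (◆ C ∨ ◆ E).
  apply: theory_mp_tHC GCE => //.
  exact: (tHC_subst (subst3 C E E) tHC_past_or).
- by move=> C BC; apply; apply: past_mono GB.
exists D; split=> // [C DC|]; last by apply: BD; apply: tHC_id.
(* Avoiding the ideal puts [◆ □ C] in [G], and [◆ □ p ⇒ p] turns this into [C]. *)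
have /NNPP := DG _ DC; apply: theory_mp_tHC => //.
exact: (tHC_subst (subst3 C C C) tHC_past_box).
Qed.

End Canonical.

(** * Filtration *)

Fixpoint subformulas (B : form) : seq form :=
  B :: match B with
       | And C D | Or C D | Imp C D => subformulas C ++ subformulas D
       | Box C | Past C => subformulas C
       | _ => [::]
       end.

Lemma subformulas_refl B : B \in subformulas B.
Proof. by case: B => *; rewrite inE eqxx. Qed.

Section Filtration.
Variable S : seq form.

(* Points that are not the type of a prime theory are kept; they are isolated. *)
Definition ftype : finType := {set seq_sub S}.

Definition type_of (G : form -> Prop) : ftype :=
  [set B : seq_sub S |
     if excluded_middle_informative (G (val B)) then true else false].

Definition in_type (x : ftype) (B : form) : Prop :=
  exists2 C : seq_sub S, C \in x & val C = B.

Lemma mem_type_of G (B : seq_sub S) : B \in type_of G <-> G (val B).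
Proof. by rewrite inE; case: excluded_middle_informative. Qed.

Lemma in_type_of {G B} : B \in S -> in_type (type_of G) B <-> G B.
Proof.
move=> SB; split=> [[C /mem_type_of GC <-] //|GB].
by exists (SeqSub SB) => //; apply/mem_type_of.
Qed.

Lemma in_type_mem {x B} : in_type x B -> B \in S.
Proof. by case=> C _ <-; apply: valP. Qed.

Lemma in_type_sub {x y : ftype} {B} : x \subset y -> in_type x B -> in_type y B.
Proof. by move/subsetP=> xy [C /xy]; exists C. Qed.

Lemma type_of_sub {G D} : (forall B, G B -> D B) -> type_of G \subset type_of D.
Proof. by move=> GD; apply/subsetP => B /mem_type_of/GD/mem_type_of. Qed.

Definition step (x y : ftype) : Prop :=
  exists G D, [/\ prime_theory G, prime_theory D, can_rel G D,
                  x = type_of G & y = type_of D].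

Definition filt_fut : relation ftype := clos_trans ftype step.
Definition filt_le : relation ftype := clos_refl ftype filt_fut.

Lemma filt_fut_sub {x y} : filt_fut x y -> x \subset y.
Proof.
elim=> [_ _ [G [D [prG _ GD -> ->]]]|? ? ? _ xy _]; last exact: subset_trans.
by apply: type_of_sub => B; apply: can_rel_sub.
Qed.

Lemma filt_le_sub {x y} : filt_le x y -> x \subset y.
Proof. by case=> // z; apply: filt_fut_sub. Qed.

Lemma filt_le_order : order ftype filt_le.
Proof.
split=> [x|x y z xy yz|x y xy yx].
- exact: r_refl.
- case: xy yz => // y' xy; case=> [z' yz|]; last exact: r_step.
  by apply: r_step; apply: t_trans yz.
- by apply/eqP; rewrite eqEsubset !filt_le_sub.
Qed.

Definition filtration : temporal_transit ftype :=
  TemporalTransit filt_le_order (fun x y => iff_refl (filt_le x y))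
    (fun x y => iff_refl (transp _ filt_fut x y)).

Lemma filt_fut_prime {x y} : filt_fut x y ->
  (exists2 G, prime_theory G & x = type_of G) /\
  (exists2 D, prime_theory D & y = type_of D).
Proof.
elim=> [_ _ [G [D [prG prD _ -> ->]]]|? ? ? _ [] ? _ _ [] //].
by split; [exists G|exists D].
Qed.

Lemma filt_le_prime {G y} : prime_theory G -> filt_le (type_of G) y ->
  exists2 D, prime_theory D & y = type_of D.
Proof. by move=> prG; case=> [z /filt_fut_prime[]|]; [|exists G]. Qed.

(** Successive steps may use different prime theories of the same type, so canonical relations along
    a chain need not compose. The first step yields [B], and later ones only enlarge types; likewise
    for [◆ B] below. *)
Lemma filt_fut_box {x y B} :
  filt_fut x y -> B \in S -> in_type x (□ B) -> in_type y B.
Proof.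
move=> xy SB; elim: xy => [_ _ [G [D [_ _ GD -> ->]]] xB|].
  apply/in_type_of => //; apply: GD.
  by move: (xB) => /(in_type_of (in_type_mem xB)).
by move=> ? ? ? _ IH /filt_fut_sub yz _ /IH; apply: in_type_sub.
Qed.

Lemma filt_fut_past {x y B} :
  filt_fut x y -> ◆ B \in S -> in_type x B -> in_type y (◆ B).
Proof.
move=> xy SB; elim: xy => [_ _ [G [D [prG _ GD -> ->]]] xB|].
  apply/in_type_of => //; apply: can_rel_past GD _ => //.
  by move: (xB) => /(in_type_of (in_type_mem xB)).
by move=> ? ? ? _ IH /filt_fut_sub yz _ /IH; apply: in_type_sub.
Qed.

Definition filt_val (n : nat) (x : ftype) : Prop := in_type x (Var n).

Lemma filt_val_upset n : upset filtration (filt_val n).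
Proof. by move=> x y /filt_le_sub; apply: in_type_sub. Qed.

Lemma truth_lemma {G B} : prime_theory G -> {subset subformulas B <= S} ->
  forces filtration filt_val (type_of G) B <-> G B.
Proof.
elim: B G => [n|||B IHB C IHC|B IHB C IHC|B IHB C IHC|B IHB|B IHB] G prG sub.
all: have SB := sub _ (subformulas_refl _).
all: have thG : theory G by case: prG.
- exact: in_type_of.
- by split=> //; case: prG.
- by split=> // _; exact: (theory_tHC thG (tHC_mHC (mHC_IPC IPC_top))).
(* The induction hypotheses shed their inclusion premise, which immediate subformulas inherit. *)
all: try have {}IHB D (prD : prime_theory D) :
       forces filtration filt_val (type_of D) B <-> D B
  by apply: IHB prD _ => E hE; apply: sub; rewrite inE ?mem_cat hE ?orbT.
all: try have {}IHC D (prD : prime_theory D) :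
       forces filtration filt_val (type_of D) C <-> D C
  by apply: IHC prD _ => E hE; apply: sub; rewrite inE ?mem_cat hE ?orbT.
all: try have SB' : B \in S
  by apply: sub; rewrite inE ?mem_cat subformulas_refl ?orbT.
- by rewrite (theory_and thG) -(IHB _ prG) -(IHC _ prG).
- by rewrite (prime_or _ _ prG) -(IHB _ prG) -(IHC _ prG).
- split=> /= [h|GBC y GD].
    apply: NNPP => /(prime_imp_witness prG)[D [prD GD DB]]; apply.
    apply/IHC => //; apply: h; last exact/IHB.
    have thD : theory D by case: prD.
    (* An extension of [G] either equals [G], giving the same point, or is a canonical successor,
       giving a step. *)
    case: (sub_can_rel prG thD GD) => [eqDG|rGD].
      suff -> : type_of D = type_of G by apply: r_refl.
      by apply/eqP; rewrite eqEsubset !type_of_sub // => E /eqDG.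
    by apply: r_step; apply: t_step; exists G, D.
  (* The theory [D] behind a higher point need not extend [G]; only the types are included, which
     suffices because [B ⇒ C] lies in [S]. *)
  have [D prD yD] := filt_le_prime prG GD; rewrite yD in GD *.
  move=> /(IHB _ prD) DB; apply/IHC => //.
  have thD : theory D by case: prD.
  apply: (theory_mp thD) DB; apply/(in_type_of SB).
  by apply: in_type_sub (filt_le_sub GD) _; apply/in_type_of.
- split=> /= [h|GB y Gy].
    apply: NNPP => /(prime_box_witness prG)[D [prD GD]]; apply.
    by apply/IHB => //; apply: h; apply: t_step; exists G, D.
  have [_ [D prD yD]] := filt_fut_prime Gy; rewrite yD in Gy *.
  apply/IHB => //; apply/(in_type_of SB'); apply: filt_fut_box Gy _ _ => //.
  exact/in_type_of.
- split=> /= [[w [wG]]|/(prime_past_witness prG)[D [prD DG DB]]].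
    have [[D prD wD] _] := filt_fut_prime wG; rewrite wD in wG *.
    move/(IHB _ prD) => DB; apply/(in_type_of SB).
    by apply: filt_fut_past wG _ _ => //; apply/in_type_of.
  exists (type_of D); split; last exact/IHB.
  by apply: t_step; exists D, G.
Qed.

End Filtration.

Theorem theorem6p10 (A : form) :
  tHC A <-> (forall (X : finType) (F : temporal_transit X), valid F A).
Proof.
split=> [hA X F|vA]; first exact: tHC_valid.
apply: NNPP => /(prime_extension_avoiding theory_tHC_set)[G [prG _]]; apply.
apply/(truth_lemma (subformulas A) prG) => //.
by apply: vA; apply: filt_val_upset.
Qed.
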